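(* For any commutative ring $A$, we have the canonical isomorphism of groups $\mathcal{B}(A)\simeq H_0(A)^{\ast}$.
   Context: $\mathcal{B}(A)=\{e\in A: e=e^2\}$ is the abelian group of idempotents of $A$ under the operation $e\oplus e':=e+e'-2ee'$. $H_0(A)$ is the ring (under pointwise operations) of all continuous functions $\operatorname{Spec}(A)\to\mathbb{Z}$, where $\operatorname{Spec}(A)$ has the Zariski topology and $\mathbb{Z}$ the discrete topology. $R^{\ast}$ denotes the group of units of a ring $R$. *)

(* Defs.v *)
From HB Require Import structures.
From mathcomp Require Import all_boot all_order all_algebra.
From mathcomp Require Import ring.
From mathcomp Require Import boolp classical_sets functions topology.

Set Implicit Arguments.
Unset Strict Implicit.
Unset Printing Implicit Defensive.

Import GRing.Theory.

Local Open Scope classical_set_scope.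
Local Open Scope ring_scope.

(* Commutative rings are [comPzRingType]s, so that the zero ring, whose
   spectrum is empty, is allowed. *)

Section Idempotents.
Variable A : comPzRingType.

Record idempotents := Idempotent {
  idem_val : A;
  _ : idem_val == idem_val ^+ 2 }.

HB.instance Definition _ := [isSub for idem_val].
HB.instance Definition _ := [Choice of idempotents by <:].

Implicit Types e f g : idempotents.

Lemma idem_val_sqr e : idem_val e * idem_val e = idem_val e.
Proof. by case: e => e /= /eqP {3}->; rewrite expr2. Qed.

Fact idem_zero_subproof : (0 : A) == 0 ^+ 2.
Proof. by rewrite expr2 mulr0. Qed.

Definition idem_zero := Idempotent idem_zero_subproof.

Fact idem_add_subproof e f :
  let x := idem_val e + idem_val f - 2 * idem_val e * idem_val f in
  x == x ^+ 2.
Proof.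
move: (idem_val_sqr e) (idem_val_sqr f) => /=.
move: (idem_val e) (idem_val f) => a b ha hb; rewrite eq_sym -subr_eq0.
have -> : (a + b - 2 * a * b) ^+ 2 - (a + b - 2 * a * b) =
  (a * a - a) * (1 - 4 * b + 4 * (b * b)) + (b * b - b) by ring.
by rewrite ha hb !subrr mul0r addr0.
Qed.

Definition idem_add e f := Idempotent (idem_add_subproof e f).

Fact idem_addA : associative idem_add.
Proof. by move=> e f g; apply: val_inj => /=; ring. Qed.

Fact idem_addC : commutative idem_add.
Proof. by move=> e f; apply: val_inj => /=; ring. Qed.

Fact idem_add0 : left_id idem_zero idem_add.
Proof. by move=> e; apply: val_inj => /=; ring. Qed.

Fact idem_addN : left_inverse idem_zero id idem_add.
Proof.
move=> e; apply: val_inj => /=; rewrite -mulrA idem_val_sqr; ring.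
Qed.

HB.instance Definition _ := GRing.isZmodule.Build idempotents
  idem_addA idem_addC idem_add0 idem_addN.

End Idempotents.

Section Spectrum.
Variable A : comPzRingType.

(* [prime_idealr] of [ring_quotient] is only available over nonzero rings. *)
Definition prime_ideal (P : set A) : Prop :=
  [/\ P 0, ~ P 1, forall a u v, P u -> P v -> P (a * u + v)
    & forall u v, P (u * v) -> P u \/ P v].

Record spec := Spec {
  spec_val : set A;
  spec_prime : prime_ideal spec_val }.

HB.instance Definition _ := gen_eqMixin spec.
HB.instance Definition _ := gen_choiceMixin spec.

Definition zero_locus (E : set A) : set spec :=
  [set p | E `<=` spec_val p].

Definition zariski_open : set_system spec :=
  [set U | exists E : set A, U = ~` zero_locus E].

Fact zariski_openT : zariski_open setT.
Proof.
exists setT; apply/seteqP; split=> // p _ /= sTp.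
by case: (spec_prime p) => _ p1 _ _; apply/p1/sTp.
Qed.

Fact zariski_openI : setI_closed zariski_open.
Proof.
move=> _ _ [E ->] [F ->]; exists [set x * y | x in E & y in F].
rewrite -setCU; congr (~` _); apply/seteqP.
split=> p.
  case: (spec_prime p) => p0 _ pD _ [] sp _ [x Ex [y Fy <-]].
    by rewrite mulrC -[_ * _]addr0; apply: pD => //; apply: sp.
  by rewrite -[_ * _]addr0; apply: pD => //; apply: sp.
move=> sp; apply: contrapT => /not_orP[/existsNP[x /not_implyP[Ex nx]]].
move=> /existsNP[y /not_implyP[Fy ny]].
case: (spec_prime p) => _ _ _ /(_ x y) [] //.
by apply: sp; exists x => //; exists y.
Qed.

Fact zariski_open_bigU (J : Type) (U : J -> set spec) :
  (forall i, zariski_open (U i)) -> zariski_open (\bigcup_i U i).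
Proof.
move=> /choice[E UE]; exists (\bigcup_i E i).
rewrite -[LHS]setCK setC_bigcup; congr (~` _).
apply/seteqP; split=> p /= sp.
  by move=> x [i _ Ex]; have := sp i Logic.I; rewrite UE setCK; apply.
by move=> i _; rewrite UE setCK => x Ex; apply: sp; exists i.
Qed.

HB.instance Definition _ := isOpenTopological.Build spec
  zariski_openT zariski_openI zariski_open_bigU.

End Spectrum.

Section H0.
Variable A : comPzRingType.

Definition continuous_int : {pred spec A -> int} :=
  fun h => `[< continuous (h : spec A -> discrete_topology int) >].

Lemma continuous_intP (h : spec A -> int) :
  continuous_int h <-> forall p, \forall q \near p, h q = h p.
Proof.
split=> [/asboolP hc p|hc].
  exact: (hc p _ (@discrete_set1 (discrete_topology int) (h p))).
apply/asboolP => p.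
apply/(@discrete_cvg (discrete_topology int)); last exact: (hc p).
by apply: fmap_filter; apply: nbhs_filter.
Qed.

Fact continuous_int_subring : subring_closed continuous_int.
Proof.
split=> [|h k|h k].
- apply/continuous_intP => p; apply: filterS filterT => q _; exact: erefl.
- move=> /continuous_intP hc /continuous_intP kc; apply/continuous_intP => p.
  by apply: filterS2 (hc p) (kc p) => q; rewrite !fctE => -> ->.
- move=> /continuous_intP hc /continuous_intP kc; apply/continuous_intP => p.
  by apply: filterS2 (hc p) (kc p) => q; rewrite !fctE => -> ->.
Qed.

(* The ring structure is inherited from the pointwise one on [spec A -> int]. *)
Record H0 := MkH0 {
  H0_val : spec A -> int;
  _ : continuous_int H0_val }.

HB.instance Definition _ := [isSub for H0_val].
HB.instance Definition _ := [Choice of H0 by <:].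
HB.instance Definition _ :=
  GRing.SubChoice_isSubComPzRing.Build (spec A -> int) continuous_int H0
    continuous_int_subring.

End H0.

(* Units are defined here for possibly zero rings, which [GRing.unit] does not
   cover. *)
Section Units.
Variable R : pzRingType.

Record units := Unit {
  unit_val : R;
  _ : `[< exists v, unit_val * v = 1 /\ v * unit_val = 1 >] }.

HB.instance Definition _ := [isSub for unit_val].
HB.instance Definition _ := [Choice of units by <:].

Implicit Types x y z : units.

Lemma unitsP x : exists v, unit_val x * v = 1 /\ v * unit_val x = 1.
Proof. by case: x => u /= /asboolP. Qed.

Fact unit_one_subproof : `[< exists v : R, 1 * v = 1 /\ v * 1 = 1 >].
Proof. by apply/asboolP; exists 1; rewrite mulr1. Qed.

Fact unit_mul_subproof x y :
  let u := unit_val x * unit_val y in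
  `[< exists v, u * v = 1 /\ v * u = 1 >].
Proof.
have [v [xv vx]] := unitsP x; have [w [yw wy]] := unitsP y.
apply/asboolP; exists (w * v); split.
  by rewrite mulrA -(mulrA (unit_val x)) yw mulr1.
by rewrite mulrA -(mulrA w) vx mulr1.
Qed.

Fact unit_inv_subproof x :
  let u := projT1 (cid (unitsP x)) in `[< exists v, u * v = 1 /\ v * u = 1 >].
Proof.
by case: cid => /= v [xv vx]; apply/asboolP; exists (unit_val x).
Qed.

Definition unit_one := Unit unit_one_subproof.
Definition unit_mul x y := Unit (unit_mul_subproof x y).
Definition unit_inv x := Unit (unit_inv_subproof x).

Fact unit_mulA : associative unit_mul.
Proof. by move=> x y z; apply: val_inj; rewrite /= mulrA. Qed.

Fact unit_mul1 : left_id unit_one unit_mul.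
Proof. by move=> x; apply: val_inj; rewrite /= mul1r. Qed.

Fact unit_mulr1 : right_id unit_one unit_mul.
Proof. by move=> x; apply: val_inj; rewrite /= mulr1. Qed.

Fact unit_mulV : left_inverse unit_one unit_inv unit_mul.
Proof. by move=> x; apply: val_inj => /=; case: cid => v []. Qed.

Fact unit_mulrV : right_inverse unit_one unit_inv unit_mul.
Proof. by move=> x; apply: val_inj => /=; case: cid => v []. Qed.

HB.instance Definition _ := isGroup.Build units
  unit_mulA unit_mul1 unit_mulr1 unit_mulV unit_mulrV.

End Units.

(* Main.v *)
(* A clopen partition of Spec A has the form V(E), V(F). Then (E) and (F) are
   comaximal, say a + b = 1 with a in (E) and b in (F), while a b lies in every
   prime ideal, so (a b) ^ n = 0 for some n. As a ^ n and b ^ n are again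
   comaximal, x a ^ n + y b ^ n = 1, and y b ^ n is an idempotent lying in
   exactly the primes of V(F). A unit of H0 only takes the values 1 and -1, so
   it is such a partition, and an idempotent is determined by the primes
   containing it: by additivity it is enough that an idempotent lying in all
   primes is nilpotent, hence zero. *)
Require Import Defs.
From HB Require Import structures.
From mathcomp Require Import all_boot all_order all_algebra.
From mathcomp Require Import ring.
From mathcomp Require Import boolp classical_sets functions topology.

Set Implicit Arguments.
Unset Strict Implicit.
Unset Printing Implicit Defensive.

Import GRing.Theory.

Local Open Scope classical_set_scope.
Local Open Scope ring_scope.

(** * Ideals, and primes avoiding a multiplicative set *)

Section Ideals.
Variable A : comPzRingType.
Implicit Types (I J E F S P : set A) (a b c x y u v : A).

Definition ideal I := I 0 /\ forall a u v, I u -> I v -> I (a * u + v).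

Lemma idealD I u v : ideal I -> I u -> I v -> I (u + v).
Proof. by move=> [_ IZ] Iu Iv; rewrite -[u]mul1r; apply: IZ. Qed.

Lemma idealM I a u : ideal I -> I u -> I (a * u).
Proof. by move=> [I0 IZ] Iu; rewrite -[_ * _]addr0; apply: IZ. Qed.

Lemma ideal_addl I u v : ideal I -> I u -> I (u + v) <-> I v.
Proof.
move=> idI Iu; split=> [Iuv|]; last exact: idealD.
have -> : v = -1 * u + (u + v) by ring.
by apply: idealD => //; apply: idealM.
Qed.

Lemma ideal0 : ideal [set 0].
Proof. by split=> [//|a u v /= -> ->]; rewrite mulr0 addr0. Qed.

Definition ideal_add I J := [set x | exists u v, [/\ I u, J v & x = u + v]].

Lemma ideal_add_ideal I J : ideal I -> ideal J -> ideal (ideal_add I J).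
Proof.
move=> [I0 IZ] [J0 JZ]; split; first by exists 0, 0; rewrite addr0.
move=> a _ _ [u [v [Iu Jv ->]]] [u' [v' [Iu' Jv' ->]]].
exists (a * u + u'), (a * v + v'); split; [exact: IZ|exact: JZ|ring].
Qed.

Lemma ideal_add_subl I J : ideal J -> I `<=` ideal_add I J.
Proof. by move=> [J0 _] u Iu; exists u, 0; rewrite addr0. Qed.

Lemma ideal_add_subr I J : ideal I -> J `<=` ideal_add I J.
Proof. by move=> [I0 _] v Jv; exists 0, v; rewrite add0r. Qed.

Definition principal x := [set u | exists a, u = a * x].

Lemma principal_ideal x : ideal (principal x).
Proof.
split=> [|c _ _ [a ->] [b ->]]; first by exists 0; rewrite mul0r.
exists (c * a + b); ring.
Qed.

Definition ideal_span E := [set x | forall I, ideal I -> E `<=` I -> I x].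

Lemma ideal_span_ideal E : ideal (ideal_span E).
Proof.
split=> [I [] //|a u v Eu Ev I idI EI].
by case: (idI) => _; apply; [apply: Eu|apply: Ev].
Qed.

Lemma sub_ideal_span E : E `<=` ideal_span E.
Proof. by move=> x Ex I _; apply. Qed.

(* The chain condition is imposed on sets [X] with [I `|` X] an ideal so that
   the union of the empty chain is admissible. *)
Lemma maximal_ideal_avoiding I S : ideal I -> I `&` S `<=` set0 ->
  exists M, [/\ ideal M, I `<=` M, M `&` S `<=` set0 &
    forall J, ideal J -> M `<=` J -> J `&` S `<=` set0 -> J `<=` M].
Proof.
move=> idI IS.
pose P : set (set A) := fun X => ideal (I `|` X) /\ (I `|` X) `&` S `<=` set0.
have chain (F : set (set A)) :
    F `<=` P -> total_on F subset -> P (\bigcup_(X in F) X).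
  move=> FP Ftot; split; last first.
    move=> x [[Ix|[X FX Xx]] Sx]; first exact: (IS x).
    by have [_ /(_ x)] := FP X FX; apply; split=> //; right.
  have bigI X x : F X -> (I `|` X) x -> (I `|` \bigcup_(X in F) X) x.
    by move=> FX [Ix|Xx]; [left|right; exists X].
  split; first by left; case: idI.
  move=> a u v [Iu|[X FX Xu]] [Iv|[Y FY Yv]].
  - by left; case: idI => _; apply.
  - by apply: (bigI Y) => //; case: (FP Y FY) => -[_ YZ] _; apply: YZ;
      [left|right].
  - by apply: (bigI X) => //; case: (FP X FX) => -[_ XZ] _; apply: XZ;
      [right|left].
  - have [XY|YX] := Ftot _ _ FX FY.
      apply: (bigI Y) => //; case: (FP Y FY) => -[_ YZ] _.
      by apply: YZ; right=> //; apply: XY.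
    apply: (bigI X) => //; case: (FP X FX) => -[_ XZ] _.
    by apply: XZ; right=> //; apply: YX.
have [M [[idM MS] Mmax]] := Zorn_bigcup chain.
exists (I `|` M); split=> // J idJ MJ JS; apply: contrapT => nJM.
have IJ : I `|` J = J by apply/setUidPr => x Ix; apply: MJ; left.
apply: (Mmax J); last by rewrite /P IJ.
split=> [x Mx|JM]; first by apply: MJ; right.
by apply: nJM => x Jx; right; apply: JM.
Qed.

(** A maximal ideal [M] among those containing [I] and disjoint from [S] is prime: for [x] and [y]
    outside [M], both [M] + ([x]) and [M] + ([y]) meet [S], and so does the product of the two
    elements found, which would lie in [M] if [x * y] did. *)
Lemma prime_avoiding I S : ideal I -> S 1 ->
    (forall x y, S x -> S y -> S (x * y)) -> I `&` S `<=` set0 ->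
  exists p : spec A, I `<=` spec_val p /\ spec_val p `&` S `<=` set0.
Proof.
move=> idI S1 SM IS.
have [M [idM IM MS Mmax]] := maximal_ideal_avoiding idI IS.
have meet x : ~ M x -> exists m a, M m /\ S (m + a * x).
  move=> nMx; apply: contrapT => nS.
  have idMx := ideal_add_ideal idM (principal_ideal x).
  apply/nMx/(Mmax _ idMx); first exact/ideal_add_subl/principal_ideal.
    by move=> _ [[m [_ [Mm [a ->] ->]]] Sma]; apply: nS; exists m, a.
  by apply: ideal_add_subr => //; exists 1; rewrite mul1r.
have Mprime : prime_ideal M.
  split.
  - by case: idM.
  - by move=> M1; apply: (MS 1).
  - by case: idM.
  - move=> x y Mxy; apply: contrapT => /not_orP[/meet[m [a [Mm Sx]]]].
    move=> /meet[n [b [Mn Sy]]].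
    apply: (MS ((m + a * x) * (n + b * y))); split; last exact: SM.
    (* Every term is a multiple of [m], [n] or [x * y], all in [M]. *)
    have -> : (m + a * x) * (n + b * y) =
      (n + b * y) * m + (a * x * n + a * b * (x * y)) by ring.
    by do 2?apply: idealD => //; apply: idealM.
by exists (Spec Mprime).
Qed.

(** If no power of [x] were zero, some prime would avoid all of them, in particular [x] itself. *)
Lemma nilpotent_of_primes x :
  (forall p : spec A, spec_val p x) -> exists n, x ^+ n = 0.
Proof.
move=> xP; apply: contrapT => nx.
have [||_ _ [m ->] [n ->]||p [_ pS]] :=
  @prime_avoiding [set 0] [set y | exists n, y = x ^+ n].
- exact: ideal0.
- by exists 0%N; rewrite expr0.
- by exists (m + n)%N; rewrite exprD.
- by move=> _ [-> [n xn]]; apply: nx; exists n.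
- by apply: (pS x); split; [exact: xP|exists 1%N; rewrite expr1].
Qed.

(** An ideal avoiding [[set 1]] is proper, so if ([E]) + ([F]) missed 1, some prime would contain
    both [E] and [F]. *)
Lemma comaximal_of_disjoint E F :
    (forall p : spec A, E `<=` spec_val p -> ~ F `<=` spec_val p) ->
  exists a b, [/\ ideal_span E a, ideal_span F b & a + b = 1].
Proof.
move=> EF; apply: contrapT => n1.
have [||_ _ -> ->||p [IJp _]] :=
  @prime_avoiding (ideal_add (ideal_span E) (ideal_span F)) [set 1].
- exact/ideal_add_ideal/ideal_span_ideal/ideal_span_ideal.
- by [].
- by rewrite /= mulr1.
- by move=> x [[a [b [Ea Fb ab]]] /= x1]; apply: n1; exists a, b; rewrite -ab.
- apply: (EF p) => x xE; apply: IJp.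
    exact: ideal_add_subl (ideal_span_ideal _) _ (sub_ideal_span xE).
  exact: ideal_add_subr (ideal_span_ideal _) _ (sub_ideal_span xE).
Qed.

(** * Comaximal elements and their powers *)

Definition comaximal a b := exists x y, x * a + y * b = 1.

Lemma comaximalC a b : comaximal a b -> comaximal b a.
Proof. by move=> [x [y xy]]; exists y, x; rewrite addrC. Qed.

(** Multiply the two relations: every term of the product except [y * t * (b * c)] is a multiple of
    [a]. *)
Lemma comaximalMr a b c : comaximal a b -> comaximal a c -> comaximal a (b * c).
Proof.
move=> [x [y xy]] [z [t zt]].
exists (x * (z * a + t * c) + y * b * z), (y * t).
by rewrite -[1]mulr1 -{1}xy -zt; ring.
Qed.

Lemma comaximalXr a b n : comaximal a b -> comaximal a (b ^+ n).
Proof.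
move=> ab; elim: n => [|n IHn]; last by rewrite exprS; apply: comaximalMr.
by exists 0, 1; rewrite mul0r add0r mulr1.
Qed.

Lemma comaximalX a b m n : comaximal a b -> comaximal (a ^+ m) (b ^+ n).
Proof. by move=> ab; do 2 apply/comaximalXr/comaximalC. Qed.

End Ideals.

(** * Idempotents and the primes containing them *)

Section Primes.
Variable A : comPzRingType.
Implicit Types (p : spec A) (e f : idempotents A).

Lemma spec_ideal p : ideal (spec_val p).
Proof. by case: (spec_prime p). Qed.

Lemma spec_span p (E : set A) :
  E `<=` spec_val p -> ideal_span E `<=` spec_val p.
Proof. by move=> Ep x; apply=> //; apply: spec_ideal. Qed.

Lemma spec_val1 p : ~ spec_val p 1.
Proof. by case: (spec_prime p). Qed.

Lemma spec_idem_compl p e :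
  spec_val p (1 - idem_val e) <-> ~ spec_val p (idem_val e).
Proof.
split=> [pe' pe|npe].
  apply: (@spec_val1 p); rewrite -[1](subrK (idem_val e)).
  exact: idealD (spec_ideal p) pe' pe.
have [_ _ _ /(_ (idem_val e) (1 - idem_val e))[]//] := spec_prime p.
by rewrite mulrBr mulr1 idem_val_sqr subrr; case: (spec_ideal p).
Qed.

(** Modulo a prime an idempotent is 0 or 1, and the group law becomes exclusive or: the sum is
    congruent to [f] if [e] is in [p], and to [1 - f] otherwise. *)
Lemma spec_idem_add p e f : spec_val p (idem_val (e + f)) <->
  (spec_val p (idem_val e) <-> spec_val p (idem_val f)).
Proof.
have idp := spec_ideal p.
have [pe|/[dup] npe /spec_idem_compl pe] := pselect (spec_val p (idem_val e)).
  have -> : idem_val (e + f) = (1 - 2 * idem_val f) * idem_val e + idem_val f.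
    by rewrite /=; ring.
  by rewrite (ideal_addl _ idp (idealM _ idp pe)); tauto.
have -> : idem_val (e + f) =
    (2 * idem_val f - 1) * (1 - idem_val e) + (1 - idem_val f).
  by rewrite /=; ring.
by rewrite (ideal_addl _ idp (idealM _ idp pe)) spec_idem_compl; tauto.
Qed.

Lemma idem_eq0 e : (forall p, spec_val p (idem_val e)) -> e = 0.
Proof.
move=> /nilpotent_of_primes[n en]; apply: val_inj => /=.
have eX k : idem_val e ^+ k.+1 = idem_val e.
  elim: k => [|k IHk]; first by rewrite expr1.
  by rewrite exprS IHk idem_val_sqr.
(* The exponent [n.+1] also covers [n = 0], which occurs in the zero ring. *)
by rewrite -(eX n) exprS en mulr0.
Qed.

Lemma idem_eq_primes e f :
  (forall p, spec_val p (idem_val e) <-> spec_val p (idem_val f)) -> e = f.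
Proof.
move=> ef; apply/eqP; rewrite -subr_eq0; apply/eqP/idem_eq0 => p.
(* Negation of idempotents is the identity, so [e - f] is [e + f] by conversion. *)
by apply/spec_idem_add/ef.
Qed.

Lemma zariski_open_not_mem (x : A) : open [set p | ~ spec_val p x].
Proof.
exists [set x]; rewrite /zero_locus; apply/seteqP.
by split=> p /= nx; [move=> /(_ x erefl)|move=> px; apply: nx => _ ->].
Qed.

Lemma idem_of_clopen (U : set (spec A)) : open U -> open (~` U) ->
  exists e, forall p, spec_val p (idem_val e) <-> U p.
Proof.
move=> [E UE] [F UF].
have UEp p : E `<=` spec_val p <-> ~ U p.
  by rewrite UE; split=> [Ep|/contrapT].
have UFp p : F `<=` spec_val p <-> U p.
  rewrite -[U]setCK UF setCK; exact: iff_refl.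
have [p Ep Fp|a [b [Ea Fb ab1]]] := @comaximal_of_disjoint A E F.
  by move: Ep => /UEp; apply; apply/UFp.
have [p|n abn] := @nilpotent_of_primes A (a * b).
  have idp := spec_ideal p.
  have [/UFp Fp|/UEp Ep] := pselect (U p).
    by apply: idealM => //; apply: spec_span Fp _ Fb.
  by rewrite mulrC; apply: idealM => //; apply: spec_span Ep _ Ea.
(* The exponent is made positive so that the powers stay multiples of [a] and [b], hence in ([E])
   and ([F]). *)
have [x [y xy]] : comaximal (a ^+ n.+1) (b ^+ n.+1).
  by apply: comaximalX; exists 1, 1; rewrite !mul1r.
have idem : y * b ^+ n.+1 == (y * b ^+ n.+1) ^+ 2.
  have : (y * b ^+ n.+1) * (x * a ^+ n.+1) = 0.
    have -> : (y * b ^+ n.+1) * (x * a ^+ n.+1) =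
      x * y * (a ^+ n.+1 * b ^+ n.+1) by ring.
    by rewrite -exprMn exprS abn !mulr0.
  have -> : x * a ^+ n.+1 = 1 - y * b ^+ n.+1 by rewrite -xy addrK.
  by rewrite mulrBr mulr1 -expr2 => /eqP; rewrite subr_eq0.
exists (Idempotent idem) => p; have idp := spec_ideal p.
split=> /= [pyb|/UFp Fp].
  (* Outside [U] the prime contains [a], so both terms of the relation [xy] would lie in it. *)
  apply: contrapT => /UEp Ep; apply: (@spec_val1 p); rewrite -xy.
  apply: idealD => //; rewrite exprSr mulrA; apply: idealM => //.
  exact: spec_span Ep _ Ea.
rewrite exprSr mulrA; apply: idealM => //.
exact: spec_span Fp _ Fb.
Qed.

End Primes.

(** * The isomorphism between idempotents and sign functions *)

Section Signs.
Variable A : comPzRingType.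
Implicit Types (p : spec A) (e f : idempotents A).

(** This is the function 1 - 2 [e], where the class of [e] modulo [p] is read as the integer 0 or
    1. *)
Definition idem_sign e p : int :=
  if `[< spec_val p (idem_val e) >] then 1 else -1.

(** The primes omitting [e] and those omitting [1 - e] form complementary open sets, on each of
    which the sign is constant. *)
Lemma idem_sign_continuous e : continuous_int (idem_sign e).
Proof.
apply/continuous_intP => p; rewrite /idem_sign.
case: (asboolP (spec_val p (idem_val e))) => [pe|npe].
  have : nbhs p [set q | ~ spec_val q (1 - idem_val e)].
    apply: open_nbhs_nbhs; split; first exact: zariski_open_not_mem.
    by move=> /spec_idem_compl.
  apply: filterS => q /= qe; rewrite asboolT //.
  by apply: contrapT => /spec_idem_compl.
have : nbhs p [set q | ~ spec_val q (idem_val e)].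
  by apply: open_nbhs_nbhs; split; first exact: zariski_open_not_mem.
by apply: filterS => q /= qe; rewrite asboolF.
Qed.

Definition idem_sign_H0 e : H0 A := MkH0 (idem_sign_continuous e).

Lemma idem_sign_H0_sqr e : idem_sign_H0 e * idem_sign_H0 e = 1.
Proof.
apply: val_inj; apply/funext => p; rewrite [LHS]/= /idem_sign.
by rewrite !fctE; case: ifP.
Qed.

Fact idem_sign_unit_subproof e :
  `[< exists v, idem_sign_H0 e * v = 1 /\ v * idem_sign_H0 e = 1 >].
Proof. by apply/asboolP; exists (idem_sign_H0 e); rewrite idem_sign_H0_sqr. Qed.

Definition idem_sign_unit e : units (H0 A) := Unit (idem_sign_unit_subproof e).

Lemma units_H0_inj (u v : units (H0 A)) :
  (forall p, H0_val (unit_val u) p = H0_val (unit_val v) p) -> u = v.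
Proof. by move=> uv; do 2 apply: val_inj; apply/funext. Qed.

(** Evaluation at [p] respects products and 1, so the value is an invertible integer. *)
Lemma unit_H0_sign (u : units (H0 A)) p :
  H0_val (unit_val u) p = 1 \/ H0_val (unit_val u) p = -1.
Proof.
have [v [_ /(congr1 (fun h => H0_val h p)) vu]] := unitsP u.
by have /orP[/eqP->|/eqP->] := intUnitRing.unitzPl vu; [left|right].
Qed.

Lemma idem_sign_unitD e f :
  idem_sign_unit (e + f) = (idem_sign_unit e * idem_sign_unit f)%g.
Proof.
apply: units_H0_inj => p.
change (idem_sign (e + f) p = idem_sign e p * idem_sign f p).
rewrite /idem_sign (asbool_equiv_eq (spec_idem_add p e f)).
by do 2!case: asboolP => ?; case: asboolP => ?; tauto.
Qed.

Lemma idem_sign_unit_inj : injective idem_sign_unit.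
Proof.
move=> e f ef; apply: idem_eq_primes => p.
have : idem_sign e p = idem_sign f p :=
  congr1 (fun u => H0_val (unit_val u) p) ef.
by rewrite /idem_sign; do 2!case: asboolP.
Qed.

Lemma H0_fiber_open (h : H0 A) (n : int) : open [set p | H0_val h p = n].
Proof.
rewrite openE => p /= hn; have /continuous_intP/(_ p) := valP h.
by apply: filterS => q /= hq; rewrite -hn; exact: hq.
Qed.

Lemma idem_sign_unit_surj (u : units (H0 A)) : exists e, idem_sign_unit e = u.
Proof.
have [||e eU] := @idem_of_clopen A [set p | H0_val (unit_val u) p = 1].
- exact: H0_fiber_open.
(* The complement is the fiber over the only other possible value, hence also open. *)
- suff -> : ~` [set p | H0_val (unit_val u) p = 1] =
      [set p | H0_val (unit_val u) p = -1] by exact: H0_fiber_open.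
  apply/seteqP; split=> p /=; last by move=> ->.
  by case: (unit_H0_sign u p).
exists e; apply: units_H0_inj => p.
change (idem_sign e p = H0_val (unit_val u) p); rewrite /idem_sign.
case: asboolP => [/eU ->//|ne]; case: (unit_H0_sign u p) => // up.
by case: ne; apply/eU.
Qed.

End Signs.

Theorem lemma4p4 (A : comPzRingType) :
  exists phi : idempotents A -> units (H0 A),
    [/\ bijective phi,
        forall e f : idempotents A, phi (e + f) = (phi e * phi f)%g
      & forall (e : idempotents A) (p : spec A),
          H0_val (unit_val (phi e)) p =
            if `[< spec_val p (idem_val e) >] then 1 else -1].
Proof.
exists (@idem_sign_unit A); split=> //; last exact: idem_sign_unitD.
(* Choice turns surjectivity into a right inverse, which injectivity makes two-sided. *)
have [g gK] := choice (@idem_sign_unit_surj A).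
exists g => // e; exact: (idem_sign_unit_inj (gK _)).
Qed.
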